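(* Let $a<b$ be real numbers and $\tau\in[0,4)$. Assume the following. (i) $f:[a,b]\to\mathbb{R}$ is decreasing and continuously differentiable with $0<\inf_{t\in[a,b]}|f'(t)|\le\sup_{t\in[a,b]}|f'(t)|<\infty$, and $F(t)=\int_a^t f(x)\,dx$ for $t\in[a,b]$. (ii) $L:[a,b]\to\mathbb{R}$ is increasing and continuously differentiable with $0<\inf_{t\in[a,b]}L'(t)\le\sup_{t\in[a,b]}L'(t)<\infty$. (iii) For each $n$, $B_n$ is a stochastic process on $[L(a),L(b)]$, and there are positive $K_1,K_2$ (not depending on $n$) such that for all $x\in[L(a),L(b)]$, $u\in(0,1]$ and $v>0$, $$\mathbb{P}\Big(\sup_{|x-y|\le u}|B_n(x)-B_n(y)|>v\Big)\le K_1\exp(-K_2v^2u^{-\tau}),$$ $$\mathbb{P}\Big(\sup_{z\ge u}\{B_n(x-z)-B_n(x)-vz^2\}>0\Big)\le K_1\exp(-K_2v^2u^{4-\tau}).$$ (iv) For each $n$, $F_n$ is a cadlag step estimator of $F$ on $[a,b]$ (a random cadlag step function), and for some sequence $\gamma_n\to0$, $$\sup_{t\in[a,b]}|F_n(t)-F(t)-n^{-1/2}B_n(L(t))|=O_p(\gamma_n).$$ Let $\widehat F_n$ be the least concave majorant of $F_n$ on $[a,b]$. Then, as $n\to\infty$, $$\sup_{x\in[a,b]}|\widehat F_n(x)-F_n(x)|=O_p(\gamma_n)+O_p\left(\Big(\frac{\log n}{n}\Big)^{2/(4-\tau)}\right).$$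
   Context: The least concave majorant of a bounded function on an interval is the smallest concave function on that interval lying above it. In the tail conditions on $B_n$, $y$ ranges over points of $[L(a),L(b)]$ with $|x-y|\le u$ and $z$ over reals $z\ge u$ with $x-z\in[L(a),L(b)]$. $(\gamma_n)$ is a deterministic sequence of positive numbers; $F_n$ and $B_n$ live on a common probability space, and suprema of processes are tacitly taken to be measurable. $O_p$ denotes boundedness in probability as $n\to\infty$. *)

(* Defs.v *)
From HB Require Import structures.
From mathcomp Require Import all_boot all_order all_algebra.
From mathcomp Require Import all_classical all_reals all_analysis.
From mathcomp Require Import measurable_realfun.

Set Implicit Arguments.
Unset Strict Implicit.
Unset Printing Implicit Defensive.

Import Order.TTheory GRing.Theory Num.Theory.
Import numFieldNormedType.Exports.

Local Open Scope classical_set_scope.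
Local Open Scope ring_scope.

Section Defs.
Context {R : realType}.
Implicit Types (a b : R) (g h : R -> R) (A : set R).

(* Supremum and infimum over A in the extended reals; supE set0 h = -oo. *)
Definition supE A h : \bar R := ereal_sup [set (h x)%:E | x in A].
Definition infE A h : \bar R := ereal_inf [set (h x)%:E | x in A].

(* Both suprema concern a path X with parameter set [l, r]; drift_sup is -oo,
   rather than 0, when no z >= u satisfies x - z \in [l, r]. *)
Definition increment_sup (l r : R) (X : R -> R) (x u : R) : \bar R :=
  supE [set y | y \in `[l, r] /\ `|x - y| <= u] (fun y => `|X x - X y|).
Definition drift_sup (l r : R) (X : R -> R) (x u v : R) : \bar R :=
  supE [set z | u <= z /\ x - z \in `[l, r]]
    (fun z => X (x - z) - X x - v * z ^+ 2).

(* Only the restriction of h to [a, b] matters: the difference quotients are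
   taken inside [a, b], so the derivative is one-sided at a and at b. *)
Definition has_continuous_derivative a b h (h' : R -> R) : Prop :=
  (forall t, t \in `[a, b] ->
     (h y - h t) / (y - t) @[y --> within `[a, b] t^'] --> h' t) /\
  {within `[a, b], continuous h'}.

Definition cadlag a b h : Prop :=
  (forall t, t \in `[a, b[ -> h y @[y --> t^'+] --> h t) /\
  (forall t, t \in `]a, b] -> cvg (h y @[y --> t^'-])).

(* h takes finitely many values: it is constant on each open cell of some
   finite partition of [a, b]. *)
Definition step_function a b h : Prop :=
  exists s : seq R, itv_partition a b s /\
    forall i, (i < size s)%N ->
      {in `]nth b (a :: s) i, nth b (a :: s) i.+1[ &, forall x y, h x = h y}.

Definition concave_on a b g : Prop :=
  convex_function (`[a, b]%classic : set R) (fun x => - g x).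

Definition least_concave_majorant a b h g : Prop :=
  [/\ concave_on a b g,
      {in `[a, b], forall x, h x <= g x} &
      forall k, concave_on a b k -> {in `[a, b], forall x, h x <= k x} ->
        {in `[a, b], forall x, g x <= k x}].

(* X_n = O_p(c_n) as n -> oo. The n-th variable may live on its own
   probability space. *)
Definition bounded_in_probability (d : nat -> measure_display)
    (T : forall n, measurableType (d n)) (P : forall n, probability (T n) R)
    (X : forall n, T n -> \bar R) (c : nat -> R) : Prop :=
  forall e : R, 0 < e -> exists2 M : R, 0 < M &
    \forall n \near \oo,
      (P n [set w | ((M * c n)%:E < `|X n w|)%E] <= e%:E)%E.

End Defs.

(* Main.v *)
Require Import Defs.
From mathcomp Require Import all_boot all_order all_algebra.
From mathcomp Require Import all_classical all_reals all_analysis.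
From mathcomp Require Import measurable_realfun.
From mathcomp Require Import ring lra.
Set Implicit Arguments.
Unset Strict Implicit.
Unset Printing Implicit Defensive.
Import Order.TTheory GRing.Theory Num.Theory.
Import numFieldNormedType.Exports.
Local Open Scope classical_set_scope.
Local Open Scope ring_scope.

(** Write eta = (Q ln n / n)^(1/(4-tau)), so that n eta^(4-tau) = Q ln n and
    eta^2 is a constant multiple of the rate r_n = (ln n / n)^(2/(4-tau)).

    The gap between h = F_n and its least concave majorant g is controlled
    pointwise: if some affine function lies above h on [a, b] and equals c at
    x, then g x <= c.  So it suffices to find, for each x, an affine function
    above F_n whose value at x exceeds F_n(x) by O(gamma_n + eta^2).  The
    tangent of F at x, shifted upwards, does it.  Since f' is bounded away
    from 0, F lies below its tangent by at least k/4 (t-x)^2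
    (primitive_quadratic_bound).  If the noise W = n^(-1/2) B_n o L satisfies
    |W x - W t| <= lam eta |x-t| + 3 eta^2, then by the inequality between the
    arithmetic and geometric means the linear term is absorbed by the
    quadratic one at the price of a multiple of eta^2
    (least_concave_majorant_gap).

    Such a modulus of W over all of [a, b] follows from the increments of B_n
    at the single scale eta: if B_n moves by at most v = n^(1/2) eta^2 within
    distance eta of each point of a grid of mesh eta, then chaining through
    the grid gives |B_n x - B_n y| <= v (|x-y|/eta + 3)
    (increment_le_grid).  At this scale the tail bound is
    K1 exp(-K2 v^2 eta^(-tau)) = K1 n^(-K2 Q), while the grid has only
    O(n^(1/(4-tau))) points, so for Q large the union bound tends to 0
    (increment_union_bound, near_increment_tail_le).

    Finally, a variable that is O_p(gamma_n + r_n) is the sum of its fractions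
    gamma_n / (gamma_n + r_n) and r_n / (gamma_n + r_n), which are O_p(gamma_n)
    and O_p(r_n) (bounded_in_probability_add_split). *)

(** * Functions with a continuous derivative on a segment *)

Lemma difference_quotient_near (R : realType) (a b : R) (h h' : R -> R) t :
  has_continuous_derivative a b h h' -> t \in `[a, b] ->
  forall e, 0 < e -> exists2 r, 0 < r &
    forall y, y \in `[a, b] -> y != t -> `|y - t| < r ->
      `|h' t - (h y - h t) / (y - t)| <= e.
Proof.
move=> [hD _] tab e e0.
have /cvgrPdist_le/(_ e e0)[r /= r0 rP] := hD t tab.
exists r => // y yab yt ytr; apply: rP => //=.
by rewrite distrC.
Qed.

(** Puts the relative derivative in the form required by the mean value
    theorem, which asks for two-sided derivatives inside the segment only. *)
Lemma is_derive_interior (R : realType) (a b : R) (h h' : R -> R) t :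
  has_continuous_derivative a b h h' ->
  t \in `]a, b[ -> is_derive t 1 h (h' t).
Proof.
move=> hC1 tab.
suff cvgh : (fun e => e^-1 *: ((h \o shift t) (e *: 1) - h t)) @ 0^' --> h' t.
  by apply: DeriveDef; [exact: cvgP cvgh|exact: cvg_lim cvgh].
have tcc : t \in `[a, b] by exact: subset_itv_oo_cc.
apply/cvgrPdist_le => e e0.
have [r r0 rP] := difference_quotient_near hC1 tcc e0.
have [s /= s0 sP] := near_in_itvoo tab.
near=> k.
have k0 : k != 0 by near: k; exact: nbhs_dnbhs_neq.
have ktab : k + t \in `[a, b].
  apply: subset_itv_oo_cc; apply: sP => /=.
  rewrite opprD addrCA subrr addr0 normrN.
  by near: k; exact: dnbhs0_lt.
have := rP (k + t) ktab.
rewrite -subr_eq0 addrK /= scaler1 [_ *: _]mulrC; apply => //.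
by near: k; exact: dnbhs0_lt.
Unshelve. all: by end_near. Qed.

Lemma within_continuous_C1 (R : realType) (a b : R) (h h' : R -> R) :
  has_continuous_derivative a b h h' -> {within `[a, b], continuous h}.
Proof.
move=> hC1; apply/subspace_continuousP => t /= tab.
have [r r0 rP] := difference_quotient_near hC1 tab ltr01.
have k0 : 0 < `|h' t| + 1 by rewrite ltr_wpDl.
apply/cvgrPdist_le => e e0.
exists (Num.min r (e / (`|h' t| + 1))) => [|y /= + yab].
  by rewrite /= lt_min r0 divr_gt0.
rewrite lt_min => /andP[].
have [->|yt] := eqVneq y t; first by move=> _ _; rewrite subrr normr0 ltW.
rewrite ![`|t - _|]distrC => ytr; rewrite ltr_pdivlMr// => yte.
rewrite distrC (le_trans _ (ltW yte))//.
rewrite mulrC -ler_pdivrMr ?normr_gt0 ?subr_eq0//.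
rewrite -normfV -normrM.
have := rP y yab yt ytr; rewrite distrC => yq.
rewrite -lerBlDl.
exact: le_trans (lerB_dist _ _) yq.
Qed.

Lemma mean_value_C1 (R : realType) (a b : R) (h h' : R -> R) x y :
  has_continuous_derivative a b h h' ->
  x \in `[a, b] -> y \in `[a, b] -> x < y ->
  exists2 c, c \in `[a, b] & h y - h x = h' c * (y - x).
Proof.
move=> hC1; rewrite !in_itv/= => /andP[ax xb] /andP[ay yb] xy.
have [c||c] := @MVT R h h' x y xy.
- rewrite in_itv/= => /andP[xc cy]; apply: is_derive_interior hC1 _.
  by rewrite in_itv/= (le_lt_trans ax) ?(lt_le_trans cy).
- apply: continuous_subspaceW (within_continuous_C1 hC1).
  by apply: subset_itv; rewrite bnd_simp.
rewrite in_itv/= => /andP[xc cy] eqc; exists c => //.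
by rewrite in_itv/= (le_trans ax (ltW xc)) (le_trans (ltW cy)).
Qed.

(** * Suprema and infima of real functions *)

Lemma infE_gt0 (R : realType) (A : set R) (h : R -> R) :
  (0 < infE A h)%E -> exists2 k, 0 < k & forall x, A x -> k <= h x.
Proof.
move=> inf0; have inf_le x : A x -> (infE A h <= (h x)%:E)%E.
  by move=> Ax; apply: ereal_inf_lbound; exists x.
case: (infE A h) inf0 inf_le => [k|_ hy|//].
  by rewrite lte_fin => k0 kh; exists k => // x /kh; rewrite lee_fin.
by exists 1 => // x /hy; rewrite leye_eq.
Qed.

Lemma le_supE (R : realType) (A : set R) (h : R -> R) x :
  A x -> ((h x)%:E <= supE A h)%E.
Proof. by move=> Ax; apply: ereal_sup_ubound; exists x. Qed.

Lemma supE_le (R : realType) (A : set R) (h : R -> R) M :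
  (forall x, A x -> h x <= M) -> (supE A h <= M%:E)%E.
Proof.
by move=> hM; apply: ge_ereal_sup => _ [x Ax <-]; rewrite lee_fin hM.
Qed.

Lemma supE_lty (R : realType) (A : set R) (h : R -> R) :
  (supE A h < +oo)%E -> exists2 k, 0 < k & forall x, A x -> h x <= k.
Proof.
move=> supy; have := @le_supE _ A h.
case: (supE A h) supy => [k _|//|_] hk; last first.
  by exists 1 => // x /hk; rewrite leeNy_eq.
exists (Num.max 1 k) => [|x /hk]; first by rewrite lt_max ltr01.
by rewrite lee_fin le_max => ->; rewrite orbT.
Qed.

(** * Consequences of the bounds on the derivatives *)

(** Monotonicity decides the sign of the derivative in the mean value theorem,
    so the lower bound on its absolute value becomes a bound on its value. *)
Lemma strong_decrease_C1 (R : realType) (a b : R) (f f' : R -> R) :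
  {in `[a, b] &, forall x y, x < y -> f y < f x} ->
  has_continuous_derivative a b f f' ->
  (0 < infE `[a, b] (fun t => `|f' t|%R))%E ->
  exists2 k, 0 < k & {in `[a, b] &, forall x y, x <= y ->
    f y <= f x - k * (y - x)}.
Proof.
move=> f_decr f_C1 /infE_gt0[k k0 kf']; exists k => // x y xab yab.
rewrite le_eqVlt => /predU1P[->|xy]; first by rewrite subrr mulr0 subr0.
have [c cab eqc] := mean_value_C1 f_C1 xab yab xy.
have := f_decr _ _ xab yab xy; rewrite -subr_lt0 eqc.
rewrite pmulr_llt0 ?subr_gt0// => f'c0.
have := kf' c cab; rewrite ltr0_norm// => kc.
rewrite -lerBlDl eqc -mulNr ler_wpM2r ?subr_ge0 ?(ltW xy)//.
by rewrite lerNr.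
Qed.

Lemma lipschitz_C1 (R : realType) (a b : R) (L L' : R -> R) :
  {in `[a, b] &, forall x y, x < y -> L x < L y} ->
  has_continuous_derivative a b L L' ->
  (supE `[a, b] L' < +oo)%E ->
  exists2 k, 0 < k & {in `[a, b] &, forall x y, `|L x - L y| <= k * `|x - y|}.
Proof.
move=> L_incr L_C1 /supE_lty[k k0 kL']; exists k => //.
suff lt_case : {in `[a, b] &, forall x y, x < y ->
    `|L x - L y| <= k * `|x - y|}.
  move=> x y xab yab; have [xy|yx|->] := ltgtP x y; first exact: lt_case.
    by rewrite distrC (distrC x); exact: lt_case.
  by rewrite !subrr !normr0 mulr0.
move=> x y xab yab xy; have [c cab eqc] := mean_value_C1 L_C1 xab yab xy.
have Lxy := ltW (L_incr _ _ xab yab xy).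
rewrite distrC (distrC x) !ger0_norm ?subr_ge0 ?(ltW xy)// eqc.
by rewrite ler_wpM2r ?subr_ge0 ?(ltW xy)// kL'.
Qed.

(** * The primitive of a strongly decreasing function *)

Lemma primitive_increment_bounds (R : realType) (a b : R) (f F : R -> R) :
  {in `[a, b] &, forall x y, x <= y -> f y <= f x} ->
  {within `[a, b], continuous f} ->
  {in `[a, b], forall t,
     F t = \int[lebesgue_measure]_(x in `[a, t]) f x} ->
  {in `[a, b] &, forall x y, x <= y ->
    f y * (y - x) <= F y - F x <= f x * (y - x)}.
Proof.
move=> f_decr f_cont F_def x y xab yab.
rewrite le_eqVlt => /predU1P[->|xy]; first by rewrite !subrr !mulr0 lexx.
have [[ax xb] [ay yb]] : (a <= x /\ x <= b) /\ (a <= y /\ y <= b).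
  by move: xab yab; rewrite !in_itv/= => /andP[? ?] /andP[].
have f_int : lebesgue_measure.-integrable `[a, b] (EFin \o f).
  by apply: continuous_compact_integrable => //; exact: segment_compact.
have xy_int : lebesgue_measure.-integrable `]x, y] (EFin \o f).
  apply: integrableS f_int => //.
  by apply: subset_itv; rewrite bnd_simp.
have sub_ab t : t \in `]x, y] -> [/\ t \in `[a, b], x <= t & t <= y].
  rewrite !in_itv/= => /andP[xt ty]; split => //; last exact: ltW.
  by rewrite (le_trans ax (ltW xt)) (le_trans ty yb).
have cst_int (r : R) : lebesgue_measure.-integrable `]x, y] (EFin \o (fun=> r)).
  have cxy_int : lebesgue_measure.-integrable `[x, y] (EFin \o cst r).
    apply: continuous_compact_integrable; first exact: segment_compact.
    by apply: continuous_subspaceT => ?; exact: cvg_cst.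
  apply: integrableS cxy_int => //.
  by apply: subset_itv; rewrite bnd_simp.
have cstE (r : R) : \int[lebesgue_measure]_(_ in `]x, y]) r = r * (y - x).
  by rewrite Rintegral_cst//= lebesgue_measure_itv/= lte_fin xy.
rewrite !F_def// Rintegral_itvB ?bnd_simp ?(ltW xy)//; last first.
  apply: integrableS f_int => //.
  by apply: subset_itv; rewrite bnd_simp.
rewrite -!cstE; apply/andP; split; apply: le_Rintegral => //; try exact: cst_int;
  by move=> t /sub_ab[tab xt ty]; exact: f_decr.
Qed.

(** On the half of the interval between x and t that is farther from x, f
    differs from f x by at least k |t - x| / 2.  Bounding f by constants on
    each half thus leaves F below its tangent by k/4 (t-x)^2: half of the
    optimal constant, without integrating the affine bound on f. *)
Lemma primitive_quadratic_bound (R : realType) (a b k : R) (f F : R -> R) :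
  {in `[a, b] &, forall x y, x <= y -> f y <= f x - k * (y - x)} ->
  {in `[a, b] &, forall x y, x <= y ->
    f y * (y - x) <= F y - F x <= f x * (y - x)} ->
  {in `[a, b] &, forall x t,
    F t <= F x + f x * (t - x) - k / 4 * (t - x) ^+ 2}.
Proof.
move=> f_decr F_bounds x t xab tab; pose m := (x + t) / 2.
have mab : m \in `[a, b].
  move: xab tab; rewrite !in_itv/= => /andP[? ?] /andP[? ?].
  by apply/andP; split; rewrite /m; lra.
have [xt|tx] := leP x t.
  have xm : x <= m by rewrite /m; lra.
  have mt : m <= t by rewrite /m; lra.
  have /andP[_ F1] := F_bounds _ _ xab mab xm.
  have /andP[_ F2] := F_bounds _ _ mab tab mt.
  have : f m * (t - m) <= (f x - k * (m - x)) * (t - m).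
    by rewrite ler_wpM2r ?subr_ge0// f_decr.
  by move: F1 F2; rewrite /m; set fm := f _; set Fm := F _; nra.
have xm : m <= x by rewrite /m; lra.
have mt : t <= m by rewrite /m; lra.
have /andP[F1 _] := F_bounds _ _ mab xab xm.
have /andP[F2 _] := F_bounds _ _ tab mab mt.
have : (f x + k * (x - m)) * (m - t) <= f m * (m - t).
  by rewrite ler_wpM2r ?subr_ge0// -lerBrDr f_decr.
by move: F1 F2; rewrite /m; set fm := f _; set Fm := F _; nra.
Qed.

(** * Least concave majorants *)

Lemma concave_on_affine (R : realType) (a b c s x : R) :
  concave_on a b (fun t => c + s * (t - x)).
Proof.
move=> t y z _ _; rewrite le_eqVlt; apply/orP; left; apply/eqP; rewrite convRE.
have -> : conv t y z = t%:num * y + (1 - t%:num) * z :> R by [].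
rewrite /unstable.onem; set p := t%:num; ring.
Qed.

Lemma least_concave_majorant_le_supporting_line
    (R : realType) (a b c s x : R) (h g : R -> R) :
  least_concave_majorant a b h g -> x \in `[a, b] ->
  {in `[a, b], forall t, h t <= c + s * (t - x)} -> g x <= c.
Proof.
move=> [_ _ g_min] xab h_le.
have := g_min _ (@concave_on_affine R a b c s x) h_le x xab.
by rewrite subrr mulr0 addr0.
Qed.

(** Induction on the partition; the midpoint of the first cell represents the
    value taken on that cell. *)
Lemma step_function_bounded (R : realType) (a b : R) (h : R -> R) :
  step_function a b h -> exists M, {in `[a, b], forall t, `|h t| <= M}.
Proof.
case=> s; elim: s a => [|x s IHs] a [].
  move=> /itv_partition_nil -> _; exists `|h b| => t.
  by rewrite in_itv/= -eq_le => /eqP ->.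
move=> part cells.
have [M hM] : exists M, {in `[x, b], forall t, `|h t| <= M}.
  apply: IHs; split; first exact: itv_partition_cons part.
  by move=> i si; exact: (cells i.+1).
exists (`|h a| + `|h ((a + x) / 2)| + `|M|) => t.
rewrite in_itv/= le_eqVlt => /andP[/predU1P[<- _|at_ tb]].
  by rewrite -addrA lerDl addr_ge0.
have [xt|tx] := leP x t.
  rewrite ler_wpDl ?addr_ge0// (le_trans _ (ler_norm M))// hM//.
  by rewrite in_itv/= xt.
rewrite (cells 0 _ t ((a + x) / 2))//= ?in_itv/= ?at_//.
  by rewrite addrAC lerDr addr_ge0.
by apply/andP; split; lra.
Qed.

(** A constant is concave, so an upper bound of h also bounds its least concave
    majorant; this makes the supremum of the gap finite. *)
Lemma least_concave_majorant_gap_bounded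
    (R : realType) (a b : R) (h g : R -> R) :
  step_function a b h -> least_concave_majorant a b h g ->
  exists M, {in `[a, b], forall x, `|g x - h x| <= M}.
Proof.
move=> /step_function_bounded[M hM] g_lcm; exists (M + M) => x xab.
have [_ hg _] := g_lcm.
have gM : g x <= M.
  apply: (@least_concave_majorant_le_supporting_line _ a b M 0 x h) => // t tab.
  by rewrite mul0r addr0 (le_trans (ler_norm _))// hM.
have := hM x xab; rewrite ler_norml => /andP[hNM _].
by rewrite ger0_norm ?subr_ge0 ?hg// lerD// lerNl.
Qed.

(** The majorizing affine function is the tangent of F at x, shifted.  Going
    from h to F + W at t and back at x costs D twice; the linear part of the
    modulus of W is absorbed by the curvature of F through
    c |t-x| <= k/4 (t-x)^2 + c^2 / k. *)
Lemma least_concave_majorant_gap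
    (R : realType) (a b k c q D : R) (f F W h g : R -> R) :
  0 < k ->
  {in `[a, b] &, forall x t,
    F t <= F x + f x * (t - x) - k / 4 * (t - x) ^+ 2} ->
  {in `[a, b] &, forall x t, `|W x - W t| <= c * `|x - t| + q} ->
  {in `[a, b], forall t, `|h t - F t - W t| <= D} ->
  least_concave_majorant a b h g ->
  {in `[a, b], forall x, `|g x - h x| <= 2 * D + (q + c ^+ 2 / k)}.
Proof.
move=> k0 F_quad W_inc h_approx g_lcm x xab.
have [_ hg _] := g_lcm.
rewrite ger0_norm ?subr_ge0 ?hg// lerBlDr addrC.
apply: (@least_concave_majorant_le_supporting_line _ a b _ (f x) x h) => //.
move=> t tab.
have := h_approx x xab; rewrite ler_norml => /andP[hx _].
have := h_approx t tab; rewrite ler_norml => /andP[_ ht].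
have := W_inc _ _ xab tab.
rewrite distrC (distrC x) => /(le_trans (ler_norm _)) Wxt.
have F_xt := F_quad _ _ xab tab.
have young : c * `|t - x| <= k / 4 * (t - x) ^+ 2 + c ^+ 2 / k.
  rewrite -[(t - x) ^+ 2]real_normK ?num_real//; set d := `|t - x|.
  rewrite -subr_ge0.
  have -> : k / 4 * d ^+ 2 + c ^+ 2 / k - c * d = k / 4 * (d - 2 * c / k) ^+ 2.
    by field; rewrite gt_eqF.
  by rewrite mulr_ge0 ?sqr_ge0// divr_ge0// ltW.
lra.
Qed.

(** * From increments on a grid to a global modulus *)

Lemma increment_sup_ge (R : realType) (l r u x y : R) (X : R -> R) :
  y \in `[l, r] -> `|x - y| <= u ->
  ((`|X x - X y|)%:E <= increment_sup l r X x u)%E.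
Proof. by move=> ylr xy; exact: le_supE. Qed.

Lemma grid_cell (R : realType) (l r eta x : R) : 0 < eta -> x \in `[l, r] ->
  let p := l + (Num.truncn ((x - l) / eta))%:R * eta in
  p <= x < p + eta.
Proof.
move=> eta0; rewrite in_itv/= => /andP[lx xr].
have /truncn_itv /andP[] : 0 <= (x - l) / eta.
  by rewrite divr_ge0 ?subr_ge0// ltW.
rewrite ler_pdivlMr// ltr_pdivrMr// -natr1 [(_ + 1) * _]mulrDl mul1r.
by move=> ? ?; apply/andP; split; lra.
Qed.

(** With i and j the cells of x and y, go from x to the grid point below x, then
    along the grid, then to y.  Each step costs at most v, and
    j - i <= |x - y| / eta + 1, which explains the constant 3. *)
Lemma increment_le_grid (R : realType) (l r eta v : R) (X : R -> R) :
  0 < eta ->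
  (forall i : nat, l + i%:R * eta <= r -> forall y, y \in `[l, r] ->
    `|l + i%:R * eta - y| <= eta -> `|X (l + i%:R * eta) - X y| <= v) ->
  {in `[l, r] &, forall x y, `|X x - X y| <= v * (`|x - y| / eta + 3)}.
Proof.
move=> eta0 X_grid.
suff le_case : {in `[l, r] &, forall x y, x <= y ->
    `|X x - X y| <= v * (`|x - y| / eta + 3)}.
  move=> x y xlr ylr; have [xy|/ltW yx] := leP x y; first exact: le_case.
  by rewrite distrC (distrC x); exact: le_case.
move=> x y xlr ylr xy.
pose p (i : nat) := l + i%:R * eta.
have Xp (i : nat) z : p i <= r -> z \in `[l, r] -> `|p i - z| <= eta ->
  `|X (p i) - X z| <= v by move=> pr; exact: X_grid.
have grid_in (i : nat) : p i <= r -> p i \in `[l, r].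
  by rewrite in_itv/= => ->; rewrite andbT lerDl mulr_ge0// ltW.
have p_le (i j : nat) : (i <= j)%N -> p i <= p j.
  by move=> ij; rewrite lerD2l ler_wpM2r ?ler_nat// ltW.
have pS (i : nat) : p i.+1 = p i + eta.
  by rewrite /p -natr1 mulrDl mul1r addrA.
have chain (i m : nat) : p (i + m)%N <= r ->
    `|X (p i) - X (p (i + m)%N)| <= m%:R * v.
  elim: m => [|m IHm]; first by rewrite addn0 subrr normr0 mul0r.
  move=> pr; have pr' : p (i + m)%N <= r.
    by apply: le_trans pr; apply: p_le; rewrite addnS.
  rewrite -natr1 [(_ + 1) * _]mulrDl mul1r.
  apply: le_trans (ler_distD (X (p (i + m)%N)) _ _) _.
  apply: lerD; first exact: IHm.
  rewrite Xp ?grid_in//.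
  by rewrite addnS pS opprD addrA subrr add0r normrN gtr0_norm.
have := grid_cell eta0 xlr; have := grid_cell eta0 ylr; rewrite /=.
set i := Num.truncn ((x - l) / eta); set j := Num.truncn ((y - l) / eta).
rewrite -/(p i) -/(p j) => /andP[pjy yp] /andP[pix xp].
have [xr yr] : x <= r /\ y <= r.
  by move: xlr ylr; rewrite !in_itv/= => /andP[_ ->] /andP[_ ->].
have ij : (i <= j)%N.
  by apply: le_truncn; rewrite ler_wpM2r ?invr_ge0 ?(ltW eta0)// lerB.
have Xi : `|X (p i) - X x| <= v.
  by rewrite Xp// ?(le_trans pix)// ler_norml; apply/andP; split; lra.
have Xj : `|X (p j) - X y| <= v.
  by rewrite Xp// ?(le_trans pjy)// ler_norml; apply/andP; split; lra.
have v0 : 0 <= v by exact: le_trans Xi.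
have := chain i (j - i)%N; rewrite subnKC// => /(_ (le_trans pjy yr)) Xij.
have ji : (j - i)%:R <= `|x - y| / eta + 1.
  rewrite ler0_norm ?subr_le0// -lerBlDr ler_pdivlMr// mulrBl mul1r natrB//.
  rewrite mulrBl.
  by move: pjy xp; rewrite /p; lra.
rewrite (_ : _ + 3 = (`|x - y| / eta + 1) + 2); last first.
  by rewrite -addrA; congr (_ + _); ring.
rewrite mulrDr; have := le_trans Xij (ler_wpM2r v0 ji).
rewrite [_ * v]mulrC => {}Xij; move: Xi; rewrite distrC => Xi.
apply: le_trans (ler_distD (X (p i)) _ _) _.
apply: le_trans (lerD Xi (ler_distD (X (p j)) _ _)) _.
apply: le_trans (lerD (lexx _) (lerD Xij Xj)) _.
by rewrite addrCA lerD2l mulr_natr mulr2n.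
Qed.

(** * Union bound for the increments of the process *)

(** Only the grid points inside [l, r] count: there are at most
    (r - l) / eta + 1 of them. *)
Lemma increment_union_bound (R : realType) (d : measure_display)
    (T : measurableType d) (P : probability T R) (l r eta v q : R)
    (X : T -> R -> R) :
  0 < eta -> l <= r ->
  {in `[l, r], forall x,
    measurable_fun [set: T] (fun w => increment_sup l r (X w) x eta)} ->
  {in `[l, r], forall x,
    (P [set w | (v%:E < increment_sup l r (X w) x eta)%E] <= q%:E)%E} ->
  exists A, [/\ measurable A, (P A <= (((r - l) / eta + 1) * q)%:E)%E &
    forall w, ~ A w -> {in `[l, r] &, forall x y,
      `|X w x - X w y| <= v * (`|x - y| / eta + 3)}].
Proof.
move=> eta0 lr mX tailX.
have lr_eta : 0 <= (r - l) / eta by rewrite divr_ge0 ?subr_ge0// ltW.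
pose N := Num.truncn ((r - l) / eta).
pose p (i : nat) := l + i%:R * eta.
pose A i := [set w | (v%:E < increment_sup l r (X w) (p i) eta)%E].
have p_in i : (i < N.+1)%N -> p i \in `[l, r].
  rewrite ltnS truncn_ge_nat// ler_pdivlMr// => iN.
  rewrite in_itv/= -lerBrDl iN andbT lerDl.
  by rewrite mulr_ge0// ltW.
have mA i : (i < N.+1)%N -> measurable (A i).
  move=> /p_in pi; rewrite -[A i]setTI.
  exact: emeasurable_fun_o_infty (mX _ pi) _.
exists (\big[setU/set0]_(i < N.+1) A i); split.
- by apply: bigsetU_measurable => i _; exact: mA.
- apply: le_trans (Boole_inequality P mA) _.
  apply: (@le_trans _ _ (\sum_(i < N.+1) q%:E)%E).
    by apply: lee_sum => i _; exact/tailX/p_in.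
  have q0 : 0 <= q.
    by rewrite -lee_fin (le_trans _ (tailX _ (p_in 0 _)))//.
  rewrite sumEFin lee_fin sumr_const card_ord -[_ *+ _]mulr_natl.
  by rewrite ler_wpM2r// -natr1 lerD2r; have /truncn_itv/andP[] := lr_eta.
- move=> w Aw; apply: increment_le_grid => // i ir y ylr iy.
  rewrite -lee_fin (le_trans (increment_sup_ge _ ylr iy))//.
  rewrite leNgt; apply/negP => viX; apply: Aw.
  rewrite -bigcup_mkord; exists i => //=.
  by rewrite ltnS truncn_ge_nat// ler_pdivlMr// lerBrDl.
Qed.

Lemma ln_le_sqrt (R : realType) (x : R) : 0 < x -> ln x <= 2 * Num.sqrt x.
Proof.
move=> x0; rewrite -{1}(sqr_sqrtr (ltW x0)) lnXn ?sqrtr_gt0//.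
rewrite -[ln _ *+ _]mulr_natl ler_pM2l//.
have s0 : 0 < Num.sqrt x by rewrite sqrtr_gt0.
have : ln (1 + (Num.sqrt x - 1)) <= Num.sqrt x - 1.
  by rewrite le_ln1Dx// ltrBrDl subrr.
by rewrite addrC subrK => /le_trans -> //; rewrite gerBl.
Qed.

(** The sublinear growth of ln, in the form that makes the scale eta at most 1
    for large n. *)
Lemma near_ln_le (R : realType) (Q : R) : 0 < Q ->
  \forall n \near \oo, Q * ln (n%:R : R) <= n%:R.
Proof.
move=> Q0; near=> n.
have n0 : 0 < n%:R :> R.
  by apply: (@lt_le_trans _ _ 1) => //; near: n; exact: nbhs_infty_ger.
apply: (@le_trans _ _ (Q * (2 * Num.sqrt n%:R))).
  by rewrite ler_pM2l// ln_le_sqrt.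
rewrite mulrA -{2}(sqr_sqrtr (ltW n0)) expr2 ler_pM2r ?sqrtr_gt0//.
rewrite -[Q * 2]ger0_norm ?mulr_ge0 ?(ltW Q0)// -sqrtr_sqr ler_wsqrtr//.
by near: n; exact: nbhs_infty_ger.
Unshelve. all: by end_near. Qed.

(** The choice of eta makes v^2 eta^(-tau) = n eta^(4-tau) = Q ln n, so a single
    increment is large with probability at most K1 n^(-K2 Q).  As 1 / eta is at
    most n^p with p = 1 / (4 - tau), taking K2 Q >= p + 1 leaves a factor 1 / n
    after summation over the grid.  The constant Q does not depend on e, hence
    neither does the multiple of the rate that bounds eta^2. *)
Lemma near_increment_tail_le (R : realType) (tau K1 K2 Lambda : R) :
  tau < 4 -> 0 < K1 -> 0 < K2 -> 0 <= Lambda ->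
  exists2 Q, 0 < Q & forall e, 0 < e -> \forall n \near \oo,
    let eta := (Q * (ln (n%:R : R) / n%:R)) `^ (4 - tau)^-1 in
    let v := n%:R `^ 2^-1 * eta ^+ 2 in
    [/\ 0 < eta <= 1, 0 < v &
     (Lambda / eta + 1) * (K1 * expR (- (K2 * v ^+ 2 * eta `^ (- tau)))) <= e].
Proof.
move=> tau4 K10 K20 Lambda0; pose p := (4 - tau)^-1.
have p0 : 0 < p by rewrite invr_gt0 subr_gt0.
(* The first entry gives x^-1 <= n below, the second beats the grid size. *)
pose Q := Num.max 1 ((p + 1) / K2).
have Q1 : 1 <= Q by rewrite le_max lexx.
have Q0 : 0 < Q by exact: lt_le_trans Q1.
have QK2 : p + 1 <= K2 * Q by rewrite mulrC -ler_pdivrMr// le_max lexx orbT.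
exists Q => // e e0; near=> n; rewrite -/p; cbv zeta.
have n1 : 1 <= n%:R :> R by near: n; exact: nbhs_infty_ger.
have n0 : 0 < n%:R :> R by exact: lt_le_trans n1.
have ln1 : 1 <= ln (n%:R : R).
  rewrite -[leLHS]expRK ler_ln ?posrE ?expR_gt0//.
  by near: n; exact: nbhs_infty_ger.
have ln_n : Q * ln (n%:R : R) <= n%:R by near: n; exact: near_ln_le.
have n_large : (Lambda + 1) * K1 / e <= n%:R by near: n; exact: nbhs_infty_ger.
set x := Q * _.
have x0 : 0 < x by rewrite mulr_gt0// divr_gt0// (lt_le_trans _ ln1).
have x1 : x <= 1 by rewrite /x mulrA ler_pdivrMr// mul1r.
have xn : x^-1 <= n%:R.
  rewrite -[leRHS]invrK lef_pV2 ?posrE ?invr_gt0// /x mulrA ler_pMl ?invr_gt0//.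
  by rewrite (le_trans Q1)// ler_peMr// ltW.
set eta := x `^ p.
have eta0 : 0 < eta by exact: powR_gt0.
(* The exponents 4 and - tau add up to the inverse of p. *)
have v_tail : (n%:R `^ 2^-1 * eta ^+ 2) ^+ 2 * eta `^ (- tau)
    = Q * ln (n%:R : R).
  have -> : (n%:R `^ 2^-1 * eta ^+ 2) ^+ 2 = n%:R * eta `^ 4%:R.
    rewrite exprMn -exprM -(powR_mulrn 2 (powR_ge0 _ _)) -powRrM.
    by rewrite mulVf// powRr1 ?ltW// powR_mulrn ?(ltW eta0).
  rewrite -mulrA -powRD; last by rewrite (gt_eqF eta0) implybT.
  rewrite /eta -powRrM mulVf ?gt_eqF ?subr_gt0// powRr1 ?(ltW x0)//.
  by rewrite /x; field; rewrite gt_eqF.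
split; first 2 last.
- rewrite -mulrA v_tail.
  have inv_eta : eta^-1 <= n%:R `^ p.
    apply: le_trans (ge0_ler_powR (ltW p0) _ _ xn);
      rewrite ?nnegrE ?invr_ge0 ?(ltW x0)//.
    by rewrite -[x^-1]powR_inv1 ?(ltW x0)// -powRrM mulN1r powRN lexx.
  have np1 : 1 <= n%:R `^ p.
    by rewrite -[leLHS](powRr0 (n%:R : R)) ler_powR// ltW.
  have tail_le : expR (- (K2 * (Q * ln (n%:R : R)))) <= (n%:R `^ p * n%:R)^-1.
    rewrite -[X in (_ * X)^-1](powRr1 (ltW n0)) -powRD ?(gt_eqF n0) ?implybT//.
    rewrite -powRN.
    rewrite /powR gt_eqF// ler_expR mulNr lerN2 mulrA ler_wpM2r//.
    exact: le_trans ln1.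
  have np0 : 0 < n%:R `^ p by exact: lt_le_trans np1.
  apply: (@le_trans _ _
      (((Lambda + 1) * n%:R `^ p) * (K1 * (n%:R `^ p * n%:R)^-1))).
    apply: ler_pM; rewrite ?addr_ge0 ?divr_ge0 ?mulr_ge0 ?expR_ge0
      ?(ltW eta0) ?(ltW K10)//.
      by rewrite mulrDl mul1r lerD// ler_wpM2l.
    by rewrite ler_pM2l.
  move: n_large; rewrite ler_pdivrMr// [_ * e]mulrC => n_large.
  rewrite (_ : _ * _ = (Lambda + 1) * K1 / n%:R); last first.
    by field; rewrite !gt_eqF.
  by rewrite ler_pdivrMr.
- rewrite eta0 /=; have := ge0_ler_powR (ltW p0) _ _ x1.
  by rewrite powR1; apply; rewrite nnegrE// ltW.
- by rewrite mulr_gt0 ?powR_gt0 ?exprn_gt0.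
Unshelve. all: by end_near. Qed.

(** * Boundedness in probability *)

Lemma measurable_gt_norm (R : realType) (d : measure_display)
    (T : measurableType d) (X : T -> \bar R) (y : \bar R) :
  measurable_fun [set: T] X -> measurable [set w | (y < `|X w|)%E].
Proof.
move=> mX; rewrite -[X in measurable X]setTI.
apply: emeasurable_fun_o_infty => //.
exact: measurableT_comp.
Qed.

Lemma bounded_in_probability_share (R : realType) (d : nat -> measure_display)
    (T : forall n, measurableType (d n)) (P : forall n, probability (T n) R)
    (S : forall n, T n -> R) (c s : nat -> R) :
  (forall n, measurable_fun [set: T n] (S n)) ->
  (forall n, 0 < s n) -> (forall n, 0 <= c n) ->
  bounded_in_probability P (fun n w => (S n w)%:E) s ->
  bounded_in_probability P (fun n w => (c n / s n * S n w)%:E) c.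
Proof.
move=> mS s0 c0 S_Op e /S_Op[M M0 nearM]; exists M => //.
near=> n.
suff sub : [set w | ((M * c n)%:E < `|(c n / s n * S n w)%:E|)%E]
    `<=` [set w | ((M * s n)%:E < `|(S n w)%:E|)%E].
  apply: (@le_trans _ _ (P n [set w | ((M * s n)%:E < `|(S n w)%:E|)%E])).
    apply: le_measure sub; rewrite inE; apply: measurable_gt_norm.
      by apply/measurable_EFinP; exact: measurable_funM.
    exact/measurable_EFinP.
  by near: n.
move=> w /=; rewrite !lte_fin normrM ger0_norm ?divr_ge0 ?(ltW (s0 n))//.
apply: contraLR; rewrite -!leNgt => Ss.
apply: le_trans (ler_wpM2l _ Ss) _; first by rewrite divr_ge0// ltW.
by rewrite mulrCA divfK// gt_eqF.
Unshelve. all: by end_near. Qed.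

(** Splitting S in proportion to the two rates makes each summand a fixed
    multiple of S: measurability is inherited, and so is the bound, rescaled
    to the rate of the summand. *)
Lemma bounded_in_probability_add_split (R : realType)
    (d : nat -> measure_display) (T : forall n, measurableType (d n))
    (P : forall n, probability (T n) R) (S : forall n, T n -> R)
    (c r : nat -> R) :
  (forall n, measurable_fun [set: T n] (S n)) ->
  (forall n, 0 < c n) -> (forall n, 0 <= r n) ->
  bounded_in_probability P (fun n w => (S n w)%:E) (fun n => c n + r n) ->
  exists U V : forall n, {RV (P n) >-> R},
    [/\ forall n w, S n w = U n w + V n w,
        bounded_in_probability P (fun n w => (U n w)%:E) c &
        bounded_in_probability P (fun n w => (V n w)%:E) r].
Proof.
move=> mS c0 r0 S_Op.
have cr0 n : 0 < c n + r n by rewrite ltr_pwDl.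
have mshare (q : nat -> R) n :
    measurable_fun [set: T n] (fun w => q n / (c n + r n) * S n w).
  exact: measurable_funM.
exists (fun n => mfun_Sub (mem_set (mshare c n))).
exists (fun n => mfun_Sub (mem_set (mshare r n))).
split.
- by move=> n w /=; rewrite -mulrDl -mulrDl divff ?mul1r// gt_eqF.
- by apply: bounded_in_probability_share => // n; exact: ltW.
- exact: bounded_in_probability_share.
Qed.

Lemma supE_norm_fin (R : realType) (A : set R) (h : R -> R) x M :
  A x -> (forall y, A y -> `|h y| <= M) ->
  (fine (supE A (fun y => `|h y|)))%:E = supE A (fun y => `|h y|).
Proof.
move=> Ax hM; apply: fineK; rewrite ge0_fin_numE.
  exact: le_lt_trans (supE_le hM) (ltry _).
by apply: le_trans (le_supE _ Ax); rewrite lee_fin.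
Qed.

(** * Distance from the estimator to its least concave majorant *)

Theorem theorem2p2 (R : realType) (a b tau : R)
  (hab : a < b) (htau : 0 <= tau < 4)
  (* (i) *)
  (f f' F : R -> R)
  (f_decr : {in `[a, b] &, forall x y, x < y -> f y < f x})
  (f_C1 : has_continuous_derivative a b f f')
  (f'_inf : (0 < infE `[a, b] (fun t => `|f' t|%R))%E)
  (f'_sup : (supE `[a, b] (fun t => `|f' t|%R) < +oo)%E)
  (F_def : {in `[a, b], forall t,
     F t = \int[lebesgue_measure]_(x in `[a, t]) f x})
  (* (ii) *)
  (L L' : R -> R)
  (L_incr : {in `[a, b] &, forall x y, x < y -> L x < L y})
  (L_C1 : has_continuous_derivative a b L L')
  (L'_inf : (0 < infE `[a, b] L')%E)
  (L'_sup : (supE `[a, b] L' < +oo)%E)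
  (* for each n, a probability space carrying both B_n and F_n *)
  (d : nat -> measure_display) (T : forall n, measurableType (d n))
  (P : forall n, probability (T n) R)
  (* (iii) *)
  (B : forall n, T n -> R -> R)
  (B_process : forall n, {in `[L a, L b], forall x,
     measurable_fun [set: T n] (fun w => B n w x)})
  (B_increment_measurable : forall n, {in `[L a, L b], forall (x u : R),
     0 < u <= 1 ->
     measurable_fun [set: T n]
       (fun w => increment_sup (L a) (L b) (B n w) x u)})
  (B_drift_measurable : forall n, {in `[L a, L b], forall (x u v : R),
     0 < u <= 1 -> 0 < v ->
     measurable_fun [set: T n]
       (fun w => drift_sup (L a) (L b) (B n w) x u v)})
  (K1 K2 : R) (hK1 : 0 < K1) (hK2 : 0 < K2)
  (B_increment_tail : forall n, {in `[L a, L b], forall (x u v : R),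
     0 < u <= 1 -> 0 < v ->
     (P n [set w | (v%:E < increment_sup (L a) (L b) (B n w) x u)%E]
      <= (K1 * expR (- (K2 * v ^+ 2 * u `^ (- tau))))%:E)%E})
  (B_drift_tail : forall n, {in `[L a, L b], forall (x u v : R),
     0 < u <= 1 -> 0 < v ->
     (P n [set w | (0 < drift_sup (L a) (L b) (B n w) x u v)%E]
      <= (K1 * expR (- (K2 * v ^+ 2 * u `^ (4 - tau))))%:E)%E})
  (* (iv) *)
  (Fn : forall n, T n -> R -> R)
  (Fn_process : forall n, {in `[a, b], forall t,
     measurable_fun [set: T n] (fun w => Fn n w t)})
  (Fn_cadlag : forall n w, cadlag a b (Fn n w))
  (Fn_step : forall n w, step_function a b (Fn n w))
  (gamma : nat -> R) (gamma_gt0 : forall n, 0 < gamma n)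
  (gamma_cvg0 : gamma n @[n --> \oo] --> (0 : R))
  (approx_sup_measurable : forall n,
     measurable_fun [set: T n] (fun w => supE `[a, b]
       (fun t => `|Fn n w t - F t - n%:R `^ (- 2^-1) * B n w (L t)|)))
  (approx : bounded_in_probability P (fun n w => supE `[a, b]
       (fun t => `|Fn n w t - F t - n%:R `^ (- 2^-1) * B n w (L t)|)) gamma)
  (* the least concave majorant of F_n *)
  (Fhat : forall n, T n -> R -> R)
  (Fhat_lcm : forall n w, least_concave_majorant a b (Fn n w) (Fhat n w))
  (Fhat_sup_measurable : forall n,
     measurable_fun [set: T n] (fun w => supE `[a, b]
       (fun x => `|Fhat n w x - Fn n w x|))) :
  exists U V : forall n, {RV (P n) >-> R},
    [/\ forall n w,
          supE `[a, b] (fun x => `|Fhat n w x - Fn n w x|)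
          = (U n w + V n w)%:E,
        bounded_in_probability P (fun n w => (U n w)%:E) gamma &
        bounded_in_probability P (fun n w => (V n w)%:E)
          (fun n => (ln n%:R / n%:R) `^ (2 / (4 - tau)))].
Proof.

have [k k0 f_strong] := strong_decrease_C1 f_decr f_C1 f'_inf.
have f_dec : {in `[a, b] &, forall x y, x <= y -> f y <= f x}.
  move=> x y xab yab xy; apply: le_trans (f_strong _ _ xab yab xy) _.
  by rewrite gerBl mulr_ge0 ?subr_ge0// ltW.
have F_quad := primitive_quadratic_bound f_strong
  (primitive_increment_bounds f_dec (within_continuous_C1 f_C1) F_def).
have [lam lam0 L_lip] := lipschitz_C1 L_incr L_C1 L'_sup.
have aab : a \in `[a, b] by rewrite in_itv/= lexx ltW.
have bab : b \in `[a, b] by rewrite in_itv/= lexx andbT ltW.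
have Lab : L a < L b by exact: L_incr.
have L_le : {in `[a, b] &, forall x y, x <= y -> L x <= L y}.
  move=> x y xab yab; rewrite le_eqVlt => /predU1P[->//|xy].
  by rewrite ltW// L_incr.
have L_in x : x \in `[a, b] -> L x \in `[L a, L b].
  move=> xab; have := xab; rewrite !in_itv/= => /andP[ax xb].
  by apply/andP; split; exact: L_le.
pose gap n w := supE `[a, b] (fun x => `|Fhat n w x - Fn n w x|).
pose S n w := fine (gap n w).
have SE n w : (S n w)%:E = gap n w.
  have [M hM] :=
    least_concave_majorant_gap_bounded (Fn_step n w) (Fhat_lcm n w).
  exact: supE_norm_fin aab hM.
have S_meas n : measurable_fun [set: T n] (S n).
  by apply: measurableT_comp => //; exact: Fhat_sup_measurable.
pose r n := (ln (n%:R : R) / n%:R) `^ (2 / (4 - tau)).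
suff S_Op : bounded_in_probability P (fun n w => (S n w)%:E)
    (fun n => gamma n + r n).
  have r0 n : 0 <= r n by exact: powR_ge0.
  have [U [V [SUV U_Op V_Op]]] :=
    bounded_in_probability_add_split S_meas gamma_gt0 r0 S_Op.
  by exists U, V; split => // n w; rewrite -SUV SE.
move: htau => /andP[_ tau4].
have Lba0 : 0 <= L b - L a by rewrite subr_ge0 ltW.
have [Q Q0 tailQ] := near_increment_tail_le tau4 hK1 hK2 Lba0.
move=> e e0; have e20 : 0 < e / 2 by rewrite divr_gt0.
have [M M0 nearM] := approx _ e20.
(* K r_n is what the modulus of the noise contributes: 3 eta^2 from its constant
   part and (lam eta)^2 / k from its linear part. *)
pose K := (3 + lam ^+ 2 / k) * Q `^ (2 / (4 - tau)).
have K0 : 0 < K.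
  rewrite mulr_gt0 ?powR_gt0// ltr_wpDr// divr_ge0 ?sqr_ge0//; exact: ltW.
exists (2 * M + K); first by rewrite addr_gt0// mulr_gt0.
pose dev n w t := Fn n w t - F t - n%:R `^ (- 2^-1) * B n w (L t).
pose err n w := supE `[a, b] (fun t => `|dev n w t|).
pose A' n := [set w | ((M * gamma n)%:E < `|err n w|)%E].
near=> n.
pose eta := (Q * (ln (n%:R : R) / n%:R)) `^ (4 - tau)^-1.
pose v := n%:R `^ 2^-1 * eta ^+ 2.
have [eta01 v0 tail_e] : [/\ 0 < eta <= 1, 0 < v &
    ((L b - L a) / eta + 1) *
      (K1 * expR (- (K2 * v ^+ 2 * eta `^ (- tau)))) <= e / 2].
  by rewrite /v /eta; near: n; exact: tailQ.
have eta0 : 0 < eta by case/andP: eta01.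
have [A [mA PA B_modulus]] := increment_union_bound eta0 (ltW Lab)
  (fun x xL => B_increment_measurable n x xL eta eta01)
  (fun x xL => B_increment_tail n x xL eta v eta01 v0).
have PA' : (P n (A' n) <= (e / 2)%:E)%E by near: n.
have mA' : measurable (A' n) by exact: measurable_gt_norm.
(* Off A the modulus of B_n holds, off A' n the approximation does. *)
suff sub : [set w | (((2 * M + K) * (gamma n + r n))%:E < `|(S n w)%:E|)%E]
    `<=` A `|` A' n.
  apply: (@le_trans _ _ (P n (A `|` A' n))).
    apply: le_measure sub; rewrite inE; last exact: measurableU.
    by apply: measurable_gt_norm; exact/measurable_EFinP.
  apply: le_trans (measureU2 (P n) mA mA') _.
  rewrite [e]splitr EFinD leeD//.
  by apply: le_trans PA _; rewrite lee_fin.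
move=> w /=; apply: contraPP => /not_orP[Aw A'w]; apply/negP; rewrite -leNgt.
have dev_le : {in `[a, b], forall t, `|dev n w t| <= M * gamma n}.
  move=> t tab; rewrite -lee_fin.
  have dev_err : ((`|dev n w t|)%:E <= err n w)%E by exact: le_supE.
  by rewrite (le_trans dev_err)// (le_trans (lee_abs _))// leNgt; apply/negP.
have scaleB : n%:R `^ (- 2^-1) * v = eta ^+ 2.
  rewrite /v mulrA powRN mulVf ?mul1r//.
  by apply: contraTN v0 => /eqP s0; rewrite /v s0 mul0r ltxx.
have W_inc : {in `[a, b] &, forall x t,
    `|n%:R `^ (- 2^-1) * B n w (L x) - n%:R `^ (- 2^-1) * B n w (L t)|
      <= lam * eta * `|x - t| + 3 * eta ^+ 2}.
  move=> x t xab tab; rewrite -mulrBr normrM ger0_norm ?powR_ge0//.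
  have B_xt := B_modulus w Aw _ _ (L_in x xab) (L_in t tab).
  apply: le_trans (ler_wpM2l (powR_ge0 _ _) B_xt) _.
  rewrite mulrA scaleB mulrDr [_ * 3]mulrC lerD2r.
  rewrite (_ : _ ^+ 2 * _ = eta * `|L x - L t|); last by field; rewrite gt_eqF.
  rewrite [lam * _]mulrC -mulrA.
  by rewrite ler_wpM2l ?(ltW eta0)// L_lip.
have gap_le := least_concave_majorant_gap k0 F_quad W_inc dev_le (Fhat_lcm n w).
rewrite lee_fin.
have S0 : 0 <= S n w.
  rewrite -lee_fin SE.
  have gap_a : ((`|Fhat n w a - Fn n w a|)%:E <= gap n w)%E by exact: le_supE.
  by apply: le_trans gap_a; rewrite lee_fin.
rewrite ger0_norm// -lee_fin SE.
apply: le_trans (supE_le gap_le) _; rewrite lee_fin.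
have eta_r : eta ^+ 2 = Q `^ (2 / (4 - tau)) * r n.
  have n1 : 1 <= n%:R :> R by near: n; exact: nbhs_infty_ger.
  rewrite /eta -(powR_mulrn 2 (powR_ge0 _ _)) -powRrM [_^-1 * _]mulrC.
  by rewrite powRM ?(ltW Q0)// divr_ge0// ln_ge0.
have -> : 2 * (M * gamma n) + (3 * eta ^+ 2 + (lam * eta) ^+ 2 / k)
    = 2 * M * gamma n + K * r n.
  by rewrite /K -[_ * _ * r n]mulrA -eta_r; field; rewrite gt_eqF.
have r0 : 0 <= r n by exact: powR_ge0.
have g0 := ltW (gamma_gt0 n).
by rewrite mulrDr lerD// ler_wpM2r// ?lerDl ?lerDr ?(ltW K0)// mulr_ge0// ltW.
Unshelve. all: by end_near. Qed.
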